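(* Let $\pi\in(0,1)$ and set $\phi_1=\frac{2-\pi}{3-\pi}$. Let $\phi_0$, with $\phi_0<\phi_1$, be the unique solution in $\phi\in(0,1)$ of $g^*(\phi)=g_0(\phi)$ (its existence being presupposed in (i) and (ii); the functions $g^*,g_0$ are defined in the context). Let $\phi\in(0,1)$ with $\pi(1-\pi)(1-\phi)<1/4$, and regard the equilibrium trading value $P_BK_B$ and cryptocurrency price $Q=P_BK_B$ as functions of $\theta\in[\theta_0,1]$. Then: (i) If $\phi<\phi_0$, then $Q$ and $P_BK_B$ are monotonically increasing in $\theta$. (ii) If $\phi_0\le\phi<\phi_1$, then $Q$ and $P_BK_B$ are U-shaped in $\theta$: there is $\theta^*$ such that $$\frac{dQ}{d\theta}=\frac{d(P_BK_B)}{d\theta}\lessgtr 0\iff \theta\lessgtr\theta^*.$$ (iii) If $\phi_1\le\phi\le 1$, then $Q$ and $P_BK_B$ are monotonically decreasing in $\theta$.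
   Context: Two platforms, the blockchain market ($B$) and the cash market ($C$), trade an asset of high or low quality. $\pi\in(0,1)$ is the economy-wide fraction of high-quality assets, $\phi\in(0,1)$ (standing assumption) is the relative value of a low-quality asset, and $\theta$ is the probability that a low-quality asset offered in $B$ is detected and rejected. Private values are uniform on $[0,1]$. $\pi_B$ is the fraction of high-quality assets among assets traded in $B$, and $\tilde\pi_B=\pi_B+(1-\pi_B)\phi$. An equilibrium is a tuple $(Q,P_B,P_C,\pi_B,K_B,K_C)$ with $P_B,P_C>0$, $K_B>0$, $K_C\ge 0$ such that both markets clear, $K_j=K_j^S=K_j^D$ for $j\in\{B,C\}$, where $$\alpha_I=\max\Big\{\tfrac{P_C-(1-\theta)P_B}{\phi\theta},0\Big\},$$ $$K_C^S=(1-\pi)\alpha_I,\qquad K_B^S=\pi P_B+(1-\pi)(1-\theta)\Big(\tfrac{P_B}{\phi}-\alpha_I\Big),$$ $$K_B^D=1-\frac{P_B-P_C}{\tilde\pi_B-\phi},\qquad K_C^D=\frac{P_B-P_C}{\tilde\pi_B-\phi}-\frac{P_C}{\phi},$$ $$\pi_B=\frac{\pi P_B}{K_B},\qquad Q=P_BK_B .$$ Note that $\tilde\pi_B-\phi=(1-\phi)\pi_B$. $\theta_0=\theta_0(\phi)\in(0,1)$ is the smaller root of $\theta^2(1-\pi)-\theta+\pi(1-\phi)=0$; for $\theta\in[\theta_0,1]$ the equilibrium exists and is unique. Derivatives at the endpoints of $[\theta_0,1]$ are one-sided. The functions used to define $\phi_0$ are $$g^*(\phi)=\frac{2\pi\big(2-\pi-\phi(3-\pi)\big)}{(1-\pi)\big(1-\pi(1-\phi)+\frac{\phi\pi}{2-\pi}\big)},\qquad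 g_0(\phi)=\frac{1-\theta_0(\phi)}{\theta_0(\phi)} .$$ *)

(* Defs.v *)
From Stdlib Require Import Reals.
Open Scope R_scope.

Definition alpha_I (phi theta PB PC : R) : R :=
  Rmax ((PC - (1 - theta) * PB) / (phi * theta)) 0.

Definition KC_supply (pi phi theta PB PC : R) : R :=
  (1 - pi) * alpha_I phi theta PB PC.

Definition KB_supply (pi phi theta PB PC : R) : R :=
  pi * PB + (1 - pi) * (1 - theta) * (PB / phi - alpha_I phi theta PB PC).

(* Value of an asset traded in market B when a fraction [piB] of them is of
   high quality; a low-quality asset is worth [phi] relative to a high-quality
   one. *)
Definition tilde_pi (phi piB : R) : R := piB + (1 - piB) * phi.

Definition KB_demand (phi PB PC piB : R) : R :=
  1 - (PB - PC) / (tilde_pi phi piB - phi).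

Definition KC_demand (phi PB PC piB : R) : R :=
  (PB - PC) / (tilde_pi phi piB - phi) - PC / phi.

Record equilibrium (pi phi theta Q PB PC piB KB KC : R) : Prop := {
  eq_PB_pos : 0 < PB;
  eq_PC_pos : 0 < PC;
  eq_KB_pos : 0 < KB;
  eq_KC_nneg : 0 <= KC;
  eq_KB_supply : KB = KB_supply pi phi theta PB PC;
  eq_KB_demand : KB = KB_demand phi PB PC piB;
  eq_KC_supply : KC = KC_supply pi phi theta PB PC;
  eq_KC_demand : KC = KC_demand phi PB PC piB;
  eq_piB : piB = pi * PB / KB;
  eq_Q : Q = PB * KB
}.

Definition theta_quadratic (pi phi theta : R) : R :=
  theta ^ 2 * (1 - pi) - theta + pi * (1 - phi).

Definition smaller_root (pi phi theta : R) : Prop :=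
  theta_quadratic pi phi theta = 0 /\
  forall t : R, theta_quadratic pi phi t = 0 -> theta <= t.

Definition gstar (pi phi : R) : R :=
  2 * pi * (2 - pi - phi * (3 - pi)) /
  ((1 - pi) * (1 - pi * (1 - phi) + phi * pi / (2 - pi))).

Definition g0 (theta0 : R -> R) (phi : R) : R :=
  (1 - theta0 phi) / theta0 phi.

Definition phi1 (pi : R) : R := (2 - pi) / (3 - pi).

Definition phi0_solution (pi : R) (theta0 : R -> R) (phi : R) : Prop :=
  0 < phi < 1 /\ gstar pi phi = g0 theta0 phi.

Definition increasing_on (a b : R) (f : R -> R) : Prop :=
  forall x y : R, a <= x -> x < y -> y <= b -> f x < f y.

Definition decreasing_on (a b : R) (f : R -> R) : Prop :=
  forall x y : R, a <= x -> x < y -> y <= b -> f y < f x.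

(* [f'] is the derivative of [f] on [[a, b]].  In [D_in] the limit of the
   difference quotient is taken within the interval, so that it is the usual
   two-sided derivative at interior points and the one-sided derivative at the
   endpoints. *)
Definition derivative_on (a b : R) (f f' : R -> R) : Prop :=
  forall x : R, a <= x <= b -> D_in f f' (fun t => a <= t <= b) x.

(* Main.v *)
(* Writing x = P_C / P_B and y = 1 - x, market clearing reduces to one quadratic
   equation for y in which theta enters only through (1 - pi)(1 - theta) / theta,
   so y increases with theta, and y = theta0 at theta = theta0.  Eliminating
   theta, the trading value is phi pi (1 - phi) / W(y) with W a concave quadratic
   that does not involve theta.  Hence the trading value falls while
   y < y* = argmax W and rises afterwards, and everything depends on the position
   of y* relative to the range [theta0, y(1)] of y.  Now g* is the value of
   (1 - theta) / theta at which y = y*, so g* = g_0 means theta0(phi) = y*(phi),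
   which has at most one solution since theta0 decreases and y* increases in phi;
   and y(1) <= y* iff g* <= 0 iff phi >= phi_1. *)
Require Import Defs.
From Stdlib Require Import Reals Lra Psatz.
From Coquelicot Require Import Coquelicot.
Open Scope R_scope.

(** * The quadratic defining theta0 *)

Lemma smaller_root_lt (pi phi r t : R) :
  0 < pi < 1 -> smaller_root pi phi r -> theta_quadratic pi phi t < 0 -> r < t.
Proof.
  unfold smaller_root, theta_quadratic; intros Hpi [Hr Hmin] Ht.
  (* By Vieta the roots sum to [1 / (1 - pi)], so this is the other root; minimality puts it at or
     above [r]. *)
  assert (Hr' : (1 / (1 - pi) - r) ^ 2 * (1 - pi) - (1 / (1 - pi) - r)
                + pi * (1 - phi) = 0).
  { replace (pi * (1 - phi)) with (r - r ^ 2 * (1 - pi)) by lra; field; lra. }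
  specialize (Hmin _ Hr').
  assert (Hfac : t ^ 2 * (1 - pi) - t + pi * (1 - phi)
                 = (1 - pi) * ((t - r) * (t - (1 / (1 - pi) - r)))).
  { replace (pi * (1 - phi)) with (r - r ^ 2 * (1 - pi)) by lra; field; lra. }
  rewrite Hfac in Ht.
  destruct (Rlt_or_le r t) as [|Hle]; [assumption|].
  assert (0 <= (r - t) * (1 / (1 - pi) - r - t)) by (apply Rmult_le_pos; lra).
  nra.
Qed.

Lemma smaller_root_bounds (pi phi r : R) :
  0 < pi < 1 -> 0 < phi < 1 -> smaller_root pi phi r -> 0 < r < 1.
Proof.
  intros Hpi Hphi Hr; split.
  - destruct Hr as [Hr _]; unfold theta_quadratic in Hr; nra.
  (* At 1 the quadratic equals [- (pi * phi)]. *)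
  - apply (smaller_root_lt pi phi); auto; unfold theta_quadratic; nra.
Qed.

Lemma theta_quadratic_nonpos (pi phi r t : R) :
  0 < pi < 1 -> 0 < phi < 1 -> smaller_root pi phi r -> r <= t <= 1 ->
  theta_quadratic pi phi t <= 0.
Proof.
  intros Hpi Hphi Hr Ht.
  pose proof (smaller_root_bounds pi phi r Hpi Hphi Hr) as Hb.
  destruct Hr as [Hr _]; unfold theta_quadratic in *.
  (* convexity, t being a convex combination of r and 1 *)
  assert (H1 : 0 <= (t - r) * (1 - t)) by (apply Rmult_le_pos; lra).
  assert (0 <= (1 - pi) * (1 - r) * ((t - r) * (1 - t))).
  { apply Rmult_le_pos; [apply Rmult_le_pos|]; lra. }
  assert (0 <= (t - r) * (pi * phi)) by (apply Rmult_le_pos; nra).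
  assert ((1 - r) * (t ^ 2 * (1 - pi) - t + pi * (1 - phi)) <= 0).
  { replace ((1 - r) * (t ^ 2 * (1 - pi) - t + pi * (1 - phi)))
      with ((1 - t) * (r ^ 2 * (1 - pi) - r + pi * (1 - phi))
            - (t - r) * (pi * phi) - (1 - pi) * (1 - r) * ((t - r) * (1 - t)))
      by ring.
    rewrite Hr; lra. }
  nra.
Qed.

(** * Reduction of market clearing to the relative discount *)

Definition adverse_weight (pi theta : R) : R := (1 - pi) * ((1 - theta) / theta).

(* The equilibrium condition on the relative discount y = 1 - P_C / P_B, once
   prices and quantities are eliminated; it depends on theta only through
   h = adverse_weight pi theta. *)
Definition discount_eq (pi phi h y : R) : Prop :=
  h * y * (y + pi * (1 - phi)) =
  (2 - pi) * (pi * (1 - phi)) - (pi * phi + (2 - pi) * (pi * (1 - phi))) * y.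

(** The quadratic W: the trading value is [phi * (pi * (1 - phi))] divided by it. *)
Definition inverse_value (pi phi y : R) : R :=
  (pi * (1 - phi) + y) * (pi * phi + (2 - pi) * (1 - y)).

Lemma equilibrium_discount (pi phi theta Q PB PC piB KB KC : R) :
  0 < pi < 1 -> 0 < phi < 1 -> 0 < theta <= 1 ->
  theta_quadratic pi phi theta <= 0 ->
  equilibrium pi phi theta Q PB PC piB KB KC ->
  exists y, 0 < y /\ discount_eq pi phi (adverse_weight pi theta) y /\
    PB * KB * inverse_value pi phi y = phi * (pi * (1 - phi)).
Proof.
  intros Hpi Hphi Hth Hq [HPB HPC HKB HKC HBS HBD HCS HCD HpiB _].
  unfold theta_quadratic in Hq.
  unfold KB_supply, KB_demand, KC_supply, KC_demand, tilde_pi in *.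
  set (s := pi * (1 - phi)) in *.
  assert (Hs : 0 < s) by (unfold s; nra).
  exists (1 - PC / PB); set (y := 1 - PC / PB).
  assert (HPCy : PC = (1 - y) * PB) by (unfold y; field; lra).
  (* Substituting [piB = pi * PB / KB] cancels [PB], so demand depends on prices only through
     [y]. *)
  assert (Hdem : (PB - PC) / (piB + (1 - piB) * phi - phi) = y * KB / s).
  { replace (piB + (1 - piB) * phi - phi) with ((1 - phi) * (pi * PB / KB))
      by (rewrite HpiB; ring).
    rewrite HPCy; unfold s; field; repeat split; lra. }
  rewrite Hdem in HBD, HCD.
  assert (HK : KB * (s + y) = s).
  { assert (H : KB * s = (1 - y * KB / s) * s) by (rewrite <- HBD; ring).
    field_simplify in H; lra. }
  assert (HPCp : 0 < PC / phi) by (apply Rdiv_lt_0_compat; lra).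
  (* Since [KC] is nonnegative, [y * KB / s] is at least [PC / phi], which is positive. *)
  assert (Hy : 0 < y).
  { assert (H : 0 < y * KB / s) by lra.
    assert (H' : y = y * KB / s * (s / KB)) by (field; lra).
    rewrite H'; apply Rmult_lt_0_compat; [assumption|].
    apply Rdiv_lt_0_compat; lra. }
  assert (Hy1 : y < 1) by nra.
  assert (Hpt : 0 < phi * theta) by (apply Rmult_lt_0_compat; lra).
  (* The corner alpha_I = 0 only occurs at the left end theta0, where y = theta. *)
  assert (Hyth : y <= theta).
  { destruct (Rle_or_lt y theta) as [|Hlt]; [assumption|exfalso].
    assert (Ha : alpha_I phi theta PB PC = 0).
    { unfold alpha_I; apply Rmax_right.
      replace (PC - (1 - theta) * PB) with (- ((y - theta) * PB))
        by (rewrite HPCy; ring).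
      rewrite Rdiv_opp_l.
      apply Rge_le, Ropp_0_le_ge_contravar, Rdiv_le_0_compat; [|assumption].
      apply Rmult_le_pos; lra. }
    rewrite Ha in HBS, HCS.
    assert (E1 : phi * s * (1 - KB) = s * (1 - y) * PB).
    { assert (H : y * KB / s = PC / phi) by lra.
      replace (1 - KB) with (y * KB / s) by lra; rewrite H, HPCy; field; lra. }
    assert (E2 : KB * phi = PB * (pi * phi + (1 - pi) * (1 - theta))).
    { rewrite HBS at 1; field; lra. }
    assert (E3 : s * (1 - KB) = y * KB) by nra.
    assert (E4 : PB * (y * (pi * phi + (1 - pi) * (1 - theta)))
                 = PB * (s * (1 - y))).
    { transitivity (y * (KB * phi)); [rewrite E2; ring|].
      transitivity (phi * (s * (1 - KB))); [rewrite E3; ring|]. lra. }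
    apply Rmult_eq_reg_l in E4; [|lra].
    (* The sign of the quadratic at [theta] reads [s <= theta * (1 - (1 - pi) * theta)], which is
       incompatible with [theta < y]. *)
    assert (E5 : y * (1 - (1 - pi) * theta) = s) by (unfold s in *; nra).
    assert (0 < 1 - (1 - pi) * theta) by nra.
    nra. }
  assert (Ha : alpha_I phi theta PB PC = PB * (theta - y) / (phi * theta)).
  { unfold alpha_I. rewrite Rmax_left.
    - rewrite HPCy; field; lra.
    - replace (PC - (1 - theta) * PB) with ((theta - y) * PB)
        by (rewrite HPCy; ring).
      apply Rdiv_le_0_compat; [apply Rmult_le_pos; lra|assumption]. }
  rewrite Ha in HBS, HCS.
  set (h := adverse_weight pi theta).
  assert (E2 : KB * phi = PB * (pi * phi + h * y)).
  { rewrite HBS at 1; unfold h, adverse_weight; field; lra. }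
  assert (E1 : (1 - KB) * phi = PB * ((2 - pi) * (1 - y) - h * y)).
  { replace (1 - KB) with (KC + PC / phi) by lra.
    rewrite HCS, HPCy; unfold h, adverse_weight; field; lra. }
  assert (E3 : s * (1 - KB) = y * KB) by nra.
  assert (E4 : PB * (y * (pi * phi + h * y))
               = PB * (s * ((2 - pi) * (1 - y) - h * y))).
  { transitivity (y * (KB * phi)); [rewrite E2; ring|].
    transitivity (s * ((1 - KB) * phi)); [|rewrite E1; ring].
    transitivity (y * KB * phi); [ring|]; rewrite <- E3; ring. }
  apply Rmult_eq_reg_l in E4; [|lra].
  repeat split; [assumption| |].
  - unfold discount_eq; fold s; lra.
  - unfold inverse_value; fold s.
    (* Adding [E1] and [E2] cancels [h * y], the only term carrying theta. *)
    assert (E5 : phi = PB * (pi * phi + (2 - pi) * (1 - y))).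
    { replace phi with (KB * phi + (1 - KB) * phi) at 1 by ring.
      rewrite E1, E2; ring. }
    transitivity (KB * (s + y) * (PB * (pi * phi + (2 - pi) * (1 - y)))); [ring|].
    rewrite <- E5, HK; ring.
Qed.

(** * The discount as a function of theta *)

(** For positive y the left side of [discount_eq] grows with h and does not fall in y, while the
    right side falls in y; a larger h moves the crossing to the left. *)
Lemma discount_eq_lt (pi phi h1 h2 y1 y2 : R) :
  0 < pi < 1 -> 0 < phi < 1 -> 0 <= h2 < h1 -> 0 < y1 -> 0 < y2 ->
  discount_eq pi phi h1 y1 -> discount_eq pi phi h2 y2 -> y1 < y2.
Proof.
  unfold discount_eq; intros Hpi Hphi Hh H1 H2 E1 E2.
  destruct (Rlt_or_le y1 y2) as [|Hle]; [assumption|exfalso].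
  set (s := pi * (1 - phi)) in *.
  assert (Hs : 0 < s) by (unfold s; nra).
  assert (0 < pi * phi + (2 - pi) * s) by nra.
  assert (P1 : 0 < y1 * (y1 + s)) by nra.
  assert (P2 : y2 * (y2 + s) <= y1 * (y1 + s)) by nra.
  assert (h2 * (y2 * (y2 + s)) <= h2 * (y1 * (y1 + s))) by nra.
  assert (h2 * (y1 * (y1 + s)) < h1 * (y1 * (y1 + s))) by nra.
  nra.
Qed.

Lemma discount_eq_unique (pi phi h y1 y2 : R) :
  0 < pi < 1 -> 0 < phi < 1 -> 0 <= h -> 0 < y1 -> 0 < y2 ->
  discount_eq pi phi h y1 -> discount_eq pi phi h y2 -> y1 = y2.
Proof.
  unfold discount_eq; intros Hpi Hphi Hh H1 H2 E1 E2.
  set (s := pi * (1 - phi)) in *.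
  assert (Hs : 0 < s) by (unfold s; nra).
  assert (0 < pi * phi + (2 - pi) * s) by nra.
  assert (Hz : (y1 - y2) * (h * (y1 + y2 + s) + (pi * phi + (2 - pi) * s)) = 0)
    by nra.
  apply Rmult_integral in Hz as [|Hz]; [lra|].
  assert (0 <= h * (y1 + y2 + s)) by (apply Rmult_le_pos; lra).
  lra.
Qed.

(** From y = 1 on, the right side of [discount_eq] is at most [- (pi * phi)], while the left side is
    nonnegative. *)
Lemma discount_lt_1 (pi phi h y : R) :
  0 < pi < 1 -> 0 < phi < 1 -> 0 <= h -> 0 < y -> discount_eq pi phi h y -> y < 1.
Proof.
  unfold discount_eq; intros Hpi Hphi Hh Hy E.
  set (s := pi * (1 - phi)) in *.
  assert (Hs : 0 < s) by (unfold s; nra).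
  assert (0 <= h * y * (y + s)) by (apply Rmult_le_pos; [apply Rmult_le_pos|]; lra).
  destruct (Rlt_or_le y 1) as [|Hle]; [assumption|exfalso].
  assert (0 < pi * phi) by nra.
  assert (0 <= (pi * phi + (2 - pi) * s) * (y - 1)) by (apply Rmult_le_pos; nra).
  lra.
Qed.

(** With y = theta the two sides of [discount_eq] differ, up to sign, by exactly [theta_quadratic].
    This fixes the left end of the range of y. *)
Lemma discount_eq_theta0 (pi phi r : R) :
  0 < r -> theta_quadratic pi phi r = 0 ->
  discount_eq pi phi (adverse_weight pi r) r.
Proof.
  unfold discount_eq, adverse_weight, theta_quadratic; intros Hr Hq.
  replace ((1 - pi) * ((1 - r) / r) * r) with ((1 - pi) * (1 - r)) by (field; lra).
  assert (E : pi * (1 - phi) = r - r ^ 2 * (1 - pi)) by lra.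
  replace (pi * phi) with (pi - pi * (1 - phi)) by ring.
  rewrite E; ring.
Qed.

Lemma adverse_weight_decr (pi t1 t2 : R) :
  pi < 1 -> 0 < t1 -> t1 < t2 -> adverse_weight pi t2 < adverse_weight pi t1.
Proof.
  intros Hpi H1 H2; unfold adverse_weight.
  apply Rmult_lt_compat_l; [lra|].
  replace ((1 - t2) / t2) with (/ t2 - 1) by (field; lra).
  replace ((1 - t1) / t1) with (/ t1 - 1) by (field; lra).
  assert (/ t2 < / t1) by (apply Rinv_lt_contravar; nra).
  lra.
Qed.

Lemma adverse_weight_nonneg (pi t : R) :
  pi < 1 -> 0 < t <= 1 -> 0 <= adverse_weight pi t.
Proof.
  intros Hpi Ht; unfold adverse_weight.
  apply Rmult_le_pos; [lra|apply Rdiv_le_0_compat; lra].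
Qed.

(** * The critical discount, g* and phi_0 *)

(* The maximizer of the concave quadratic [inverse_value pi phi]. *)
Definition critical_discount (pi phi : R) : R :=
  (1 - pi * (1 - phi) + phi * pi / (2 - pi)) / 2.

Lemma critical_discount_pos (pi phi : R) :
  0 < pi < 1 -> 0 < phi < 1 -> 0 < critical_discount pi phi.
Proof.
  intros Hpi Hphi; unfold critical_discount.
  assert (0 < phi * pi / (2 - pi)) by (apply Rdiv_lt_0_compat; nra).
  nra.
Qed.

Lemma critical_discount_incr (pi phi phi' : R) :
  0 < pi < 1 -> phi < phi' -> critical_discount pi phi < critical_discount pi phi'.
Proof.
  intros Hpi H; unfold critical_discount.
  assert (phi * pi / (2 - pi) < phi' * pi / (2 - pi)).
  { apply Rmult_lt_compat_r; [apply Rinv_0_lt_compat|]; nra. }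
  nra.
Qed.

(** The last factor in the denominator of g* is twice the critical discount. The sign of g* is left
    free, so that the regime above [phi1] is covered too. *)
Lemma discount_eq_gstar (pi phi : R) :
  0 < pi < 1 -> 0 < phi < 1 ->
  discount_eq pi phi ((1 - pi) * gstar pi phi) (critical_discount pi phi).
Proof.
  intros Hpi Hphi.
  pose proof (critical_discount_pos pi phi Hpi Hphi) as Hc.
  unfold discount_eq, gstar.
  replace (1 - pi * (1 - phi) + phi * pi / (2 - pi))
    with (2 * critical_discount pi phi) by (unfold critical_discount; lra).
  replace ((1 - pi) * (2 * pi * (2 - pi - phi * (3 - pi))
             / ((1 - pi) * (2 * critical_discount pi phi))) * critical_discount pi phi)
    with (pi * (2 - pi - phi * (3 - pi))) by (field; lra).
  unfold critical_discount; field; lra.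
Qed.

(** The secant form of a quadratic with leading coefficient [- (2 - pi)]: growth is decided by the
    midpoint's position relative to the vertex. *)
Lemma inverse_value_diff (pi phi y1 y2 : R) :
  0 < pi < 1 ->
  inverse_value pi phi y2 - inverse_value pi phi y1 =
  (2 - pi) * (y2 - y1) * (2 * critical_discount pi phi - (y1 + y2)).
Proof. intros Hpi; unfold inverse_value, critical_discount; field; lra. Qed.

Lemma inverse_value_pos (pi phi y : R) :
  0 < pi < 1 -> 0 < phi < 1 -> 0 < y < 1 -> 0 < inverse_value pi phi y.
Proof.
  intros Hpi Hphi Hy; unfold inverse_value; apply Rmult_lt_0_compat; nra.
Qed.

Lemma gstar_pos_iff (pi phi : R) :
  0 < pi < 1 -> 0 < phi < 1 -> (0 < gstar pi phi <-> phi < phi1 pi).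
Proof.
  intros Hpi Hphi.
  pose proof (critical_discount_pos pi phi Hpi Hphi) as Hc.
  unfold critical_discount in Hc; unfold gstar, phi1.
  set (d := (1 - pi) * (1 - pi * (1 - phi) + phi * pi / (2 - pi))).
  assert (Hd : 0 < d) by (apply Rmult_lt_0_compat; lra).
  rewrite <- (Rlt_div_r phi) by lra.
  split; intros H.
  - assert (Hn : 0 < 2 * pi * (2 - pi - phi * (3 - pi)) / d * d)
      by (apply Rmult_lt_0_compat; assumption).
    unfold Rdiv in Hn; rewrite Rmult_assoc, Rinv_l in Hn by lra; nra.
  - apply Rdiv_lt_0_compat; nra.
Qed.

(** When g* = g_0, theta0 and the critical discount are positive solutions of [discount_eq] for the
    same h, hence equal; g_0 > 0 makes g* positive. *)
Lemma phi0_solution_critical (pi phi : R) (theta0 : R -> R) :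
  0 < pi < 1 -> smaller_root pi phi (theta0 phi) ->
  phi0_solution pi theta0 phi ->
  theta0 phi = critical_discount pi phi /\ phi < phi1 pi.
Proof.
  intros Hpi Hr [Hphi Hg].
  pose proof (smaller_root_bounds _ _ _ Hpi Hphi Hr) as Hb.
  assert (Hg0 : 0 < gstar pi phi).
  { rewrite Hg; unfold g0; apply Rdiv_lt_0_compat; lra. }
  split; [|apply gstar_pos_iff; assumption].
  apply (discount_eq_unique pi phi ((1 - pi) * gstar pi phi)); try lra.
  - apply Rmult_le_pos; lra.
  - apply critical_discount_pos; assumption.
  - rewrite Hg; apply discount_eq_theta0; [lra|exact (proj1 Hr)].
  - apply discount_eq_gstar; assumption.
Qed.

(** Raising [phi] lowers the quadratic, so it is negative at the old root. *)
Lemma smaller_root_decr (pi phi phi' r r' : R) :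
  0 < pi < 1 -> phi < phi' ->
  smaller_root pi phi r -> smaller_root pi phi' r' -> r' < r.
Proof.
  intros Hpi H [Hr _] Hr'.
  apply (smaller_root_lt pi phi'); auto.
  unfold theta_quadratic in *; nra.
Qed.

(** * Explicit discount and derivatives in theta *)

(* The positive root of [discount_eq], rationalized so as to be smooth at h = 0. *)
Definition discount_root (pi phi h : R) : R :=
  let s := pi * (1 - phi) in
  let p := pi * phi + (2 - pi) * s + s * h in
  2 * ((2 - pi) * s) / (p + sqrt (p ^ 2 + 4 * ((2 - pi) * s) * h)).

Lemma discount_root_spec (pi phi h : R) :
  0 < pi < 1 -> 0 < phi < 1 -> 0 <= h ->
  0 < discount_root pi phi h /\ discount_eq pi phi h (discount_root pi phi h).
Proof.
  intros Hpi Hphi Hh; unfold discount_root, discount_eq.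
  set (s := pi * (1 - phi)).
  assert (Hs : 0 < s) by (unfold s; nra).
  set (p := pi * phi + (2 - pi) * s + s * h).
  assert (Hp : 0 < p) by (unfold p; nra).
  assert (Hc : 0 < (2 - pi) * s) by nra.
  set (c := (2 - pi) * s) in *; cbv zeta.
  assert (Hd : 0 <= p ^ 2 + 4 * c * h) by nra.
  set (w := sqrt (p ^ 2 + 4 * c * h)).
  assert (Hw : 0 <= w) by apply sqrt_pos.
  assert (Hw2 : w * w = p ^ 2 + 4 * c * h) by (apply sqrt_sqrt; assumption).
  split; [apply Rdiv_lt_0_compat; lra|].
  assert (Hy : 2 * c / (p + w) * (p + w) = 2 * c) by (field; lra).
  set (y := 2 * c / (p + w)) in *.
  (* This is [discount_eq] collected in powers of [y]; clearing [(p + w) ^ 2] reduces it to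
     [Hw2]. *)
  assert (E : h * y ^ 2 + p * y - c = 0).
  { apply Rmult_eq_reg_r with ((p + w) ^ 2); [|apply pow_nonzero; lra].
    transitivity (h * (y * (p + w)) ^ 2 + p * (y * (p + w)) * (p + w) - c * (p + w) ^ 2);
      [ring|]; rewrite Hy.
    transitivity (c * (p ^ 2 + 4 * c * h - w * w)); [ring|rewrite Hw2; ring]. }
  unfold p in E; lra.
Qed.

(** Both factors of the chain rule are negative. At t = 1, where h = 0, the derivative is still
    two-sided, since the radicand stays positive for slightly negative h. *)
Lemma discount_root_derive (pi phi t : R) :
  0 < pi < 1 -> 0 < phi < 1 -> 0 < t <= 1 ->
  exists d, 0 < d /\
    is_derive (fun u => discount_root pi phi (adverse_weight pi u)) t d.
Proof.
  intros Hpi Hphi Ht.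
  assert (Hh : is_derive (adverse_weight pi) t (- ((1 - pi) / t ^ 2))).
  { unfold adverse_weight; auto_derive; [lra|field; lra]. }
  pose proof (adverse_weight_nonneg pi t ltac:(lra) Ht) as Hh0.
  set (h := adverse_weight pi t) in *.
  set (s := pi * (1 - phi)).
  assert (Hs : 0 < s) by (unfold s; nra).
  set (p := pi * phi + (2 - pi) * s + s * h).
  assert (Hp : 0 < p) by (unfold p; nra).
  assert (Hc : 0 < (2 - pi) * s) by nra.
  assert (Hd : 0 < p ^ 2 + 4 * ((2 - pi) * s) * h) by nra.
  set (w := sqrt (p ^ 2 + 4 * ((2 - pi) * s) * h)).
  assert (Hw : 0 < w) by (apply sqrt_lt_R0; assumption).
  (* [e] is the derivative of [discount_root] in h; [p] has slope [s] in h. *)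
  set (e := - (2 * ((2 - pi) * s) * (s + (p * s + 2 * ((2 - pi) * s)) / w) / (p + w) ^ 2)).
  assert (He : e < 0).
  { apply Ropp_lt_gt_0_contravar, Rdiv_lt_0_compat; [|nra].
    apply Rmult_lt_0_compat; [lra|].
    assert (0 < (p * s + 2 * ((2 - pi) * s)) / w) by (apply Rdiv_lt_0_compat; nra).
    lra. }
  exists (- ((1 - pi) / t ^ 2) * e); split.
  - assert (0 < (1 - pi) / t ^ 2)
      by (apply Rdiv_lt_0_compat; [lra|apply pow_lt; lra]).
    nra.
  - apply (is_derive_comp (discount_root pi phi)); [|exact Hh].
    unfold discount_root; fold h; fold s; cbv zeta.
    auto_derive.
    + fold p; replace (p * (p * 1)) with (p ^ 2) by ring; fold w.
      repeat split; lra.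
    + fold p; replace (p * (p * 1)) with (p ^ 2) by ring; fold w.
      unfold e; field; lra.
Qed.

(** Uniqueness of the positive discount replaces an arbitrary equilibrium selection by an explicit
    function that can be differentiated in theta. *)
Lemma equilibrium_value (pi phi r theta Q PB PC piB KB KC : R) :
  0 < pi < 1 -> 0 < phi < 1 -> smaller_root pi phi r -> r <= theta <= 1 ->
  equilibrium pi phi theta Q PB PC piB KB KC ->
  PB * KB = phi * (pi * (1 - phi)) /
    inverse_value pi phi (discount_root pi phi (adverse_weight pi theta)).
Proof.
  intros Hpi Hphi Hr Ht Heq.
  pose proof (smaller_root_bounds _ _ _ Hpi Hphi Hr) as Hb.
  assert (Ht0 : 0 < theta <= 1) by lra.
  destruct (equilibrium_discount _ _ _ _ _ _ _ _ _ Hpi Hphi Ht0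
    (theta_quadratic_nonpos _ _ _ _ Hpi Hphi Hr Ht) Heq) as (y & Hy & Hdis & HV).
  pose proof (adverse_weight_nonneg pi theta ltac:(lra) ltac:(lra)) as Hh.
  destruct (discount_root_spec pi phi _ Hpi Hphi Hh) as [Hp Hdr].
  rewrite (discount_eq_unique _ _ _ _ _ Hpi Hphi Hh Hp Hy Hdr Hdis), <- HV.
  pose proof (inverse_value_pos pi phi y Hpi Hphi
    (conj Hy (discount_lt_1 _ _ _ _ Hpi Hphi Hh Hy Hdis))).
  field; lra.
Qed.

Lemma value_derive (pi phi t : R) :
  0 < pi < 1 -> 0 < phi < 1 -> 0 < t <= 1 ->
  let Y u := discount_root pi phi (adverse_weight pi u) in
  exists c, 0 < c /\
    is_derive (fun u => phi * (pi * (1 - phi)) / inverse_value pi phi (Y u)) t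
      (c * (Y t - critical_discount pi phi)).
Proof.
  intros Hpi Hphi Ht Y.
  pose proof (adverse_weight_nonneg pi t ltac:(lra) Ht) as Hh.
  destruct (discount_root_spec pi phi _ Hpi Hphi Hh) as [Hp Hdr].
  pose proof (discount_lt_1 _ _ _ _ Hpi Hphi Hh Hp Hdr) as H1.
  pose proof (inverse_value_pos pi phi _ Hpi Hphi (conj Hp H1)) as HW.
  destruct (discount_root_derive pi phi t Hpi Hphi Ht) as (d & Hd & HY).
  fold (Y t) in Hp, H1, HW.
  exists (2 * (2 - pi) * (phi * (pi * (1 - phi))) * d / inverse_value pi phi (Y t) ^ 2).
  split.
  - apply Rdiv_lt_0_compat; [|apply pow_lt; assumption].
    repeat apply Rmult_lt_0_compat; lra.
  - evar_last.
    + apply (is_derive_comp (fun y => phi * (pi * (1 - phi)) / inverse_value pi phi y));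
        [|exact HY].
      unfold inverse_value; auto_derive; [|reflexivity].
      unfold inverse_value in HW; lra.
    + unfold scal; simpl; unfold mult; simpl.
      fold (Y t); unfold inverse_value, critical_discount in *; field.
      repeat split; apply Rgt_not_eq; nra.
Qed.

(** Transfers the two-sided derivative of [F] to [f], which is controlled only on the interval,
    hence one-sidedly at its ends. *)
Lemma derivative_on_ext (a b : R) (f F dF : R -> R) :
  (forall t, a <= t <= b -> f t = F t) ->
  (forall t, a <= t <= b -> is_derive F t (dF t)) ->
  derivative_on a b f dF.
Proof.
  intros Hext HF x Hx eps Heps.
  pose proof (proj1 (is_derive_Reals _ _ _) (HF x Hx)) as Hd.
  destruct (Hd eps Heps) as [delta Hdelta].
  exists delta; split; [apply cond_pos|].
  intros t [[Ht Hne] Hdist]; simpl in *; unfold Rdist in *.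
  rewrite (Hext t Ht), (Hext x Hx).
  replace t with (x + (t - x)) at 1 by ring.
  apply Hdelta; lra.
Qed.

(** * Uniqueness of phi_0 and the three regimes of phi *)

Theorem proposition5 (pi : R) (Hpi : 0 < pi < 1)
  (theta0 : R -> R)
  (Htheta0 : forall phi : R, 0 < phi < 1 -> smaller_root pi phi (theta0 phi)) :
  (forall phi0 : R, phi0_solution pi theta0 phi0 ->
     unique (phi0_solution pi theta0) phi0 /\ phi0 < phi1 pi) /\
  (forall phi : R, 0 < phi < 1 -> pi * (1 - pi) * (1 - phi) < 1 / 4 ->
   forall Q PB PC piB KB KC : R -> R,
   (forall theta : R, theta0 phi <= theta <= 1 ->
      equilibrium pi phi theta (Q theta) (PB theta) (PC theta) (piB theta)
        (KB theta) (KC theta)) ->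
   let V := fun theta : R => PB theta * KB theta in
   (* (i) *)
   (forall phi0 : R, phi0_solution pi theta0 phi0 -> phi < phi0 ->
      increasing_on (theta0 phi) 1 Q /\ increasing_on (theta0 phi) 1 V) /\
   (* (ii) *)
   (forall phi0 : R, phi0_solution pi theta0 phi0 -> phi0 <= phi < phi1 pi ->
      exists (thetastar : R) (dQ : R -> R),
        theta0 phi <= thetastar < 1 /\
        derivative_on (theta0 phi) 1 Q dQ /\
        derivative_on (theta0 phi) 1 V dQ /\
        forall theta : R, theta0 phi <= theta <= 1 ->
          (dQ theta < 0 <-> theta < thetastar) /\
          (dQ theta > 0 <-> theta > thetastar)) /\
   (* (iii) *)
   (phi1 pi <= phi <= 1 ->
      decreasing_on (theta0 phi) 1 Q /\ decreasing_on (theta0 phi) 1 V)).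
Proof.
  assert (Hcrit : forall phi, phi0_solution pi theta0 phi ->
    theta0 phi = critical_discount pi phi /\ phi < phi1 pi).
  { intros phi H; apply phi0_solution_critical; auto; apply Htheta0, H. }
  assert (Hcross : forall phi phi', phi0_solution pi theta0 phi' -> 0 < phi < 1 ->
    (phi < phi' -> critical_discount pi phi < theta0 phi) /\
    (phi' < phi -> theta0 phi < critical_discount pi phi)).
  { intros phi phi' Hs Hphi; destruct (Hcrit _ Hs) as [E _].
    split; intros Hlt.
    - pose proof (critical_discount_incr pi phi phi' Hpi Hlt).
      pose proof (smaller_root_decr pi phi phi' _ _ Hpi Hlt
        (Htheta0 _ Hphi) (Htheta0 _ (proj1 Hs))); lra.
    - pose proof (critical_discount_incr pi phi' phi Hpi Hlt).
      pose proof (smaller_root_decr pi phi' phi _ _ Hpi Hlt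
        (Htheta0 _ (proj1 Hs)) (Htheta0 _ Hphi)); lra. }
  split.
  { intros phi0 H0; split; [|apply Hcrit; assumption].
    split; [assumption|]; intros phi H.
    destruct (Hcross phi phi0 H0 (proj1 H)) as [Hl Hg].
    destruct (Hcrit _ H) as [E _].
    destruct (Rtotal_order phi phi0) as [Hlt|[Heq|Hgt]]; [|congruence|].
    - specialize (Hl Hlt); lra.
    - specialize (Hg Hgt); lra. }
  intros phi Hphi _ Q PB PC piB KB KC Heq V.
  pose proof (Htheta0 phi Hphi) as Hr.
  set (r := theta0 phi) in *.
  pose proof (smaller_root_bounds _ _ _ Hpi Hphi Hr) as Hrb.
  set (Y := fun t => discount_root pi phi (adverse_weight pi t)).
  set (ys := critical_discount pi phi) in *.
  set (k := phi * (pi * (1 - phi))).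
  assert (Hk : 0 < k) by (unfold k; repeat apply Rmult_lt_0_compat; lra).
  assert (HV : forall t, r <= t <= 1 -> V t = k / inverse_value pi phi (Y t)).
  { intros t Ht; apply (equilibrium_value _ _ r _ _ _ _ _ _ _ Hpi Hphi Hr Ht (Heq t Ht)). }
  assert (HQ : forall t, r <= t <= 1 -> Q t = V t).
  { intros t Ht; exact (eq_Q _ _ _ _ _ _ _ _ _ (Heq t Ht)). }
  assert (Hh : forall t, 0 < t <= 1 -> 0 <= adverse_weight pi t)
    by (intros; apply adverse_weight_nonneg; lra).
  assert (HY : forall t, 0 < t <= 1 ->
    0 < Y t /\ discount_eq pi phi (adverse_weight pi t) (Y t))
    by (intros; apply discount_root_spec; auto).
  assert (HYlt : forall t u, 0 < t -> t < u -> u <= 1 -> Y t < Y u).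
  { intros t u H1 H2 H3.
    apply (discount_eq_lt pi phi (adverse_weight pi t) (adverse_weight pi u)); auto;
      try (apply HY; lra).
    split; [apply Hh|apply adverse_weight_decr]; lra. }
  assert (HYr : Y r = r).
  { apply (discount_eq_unique pi phi (adverse_weight pi r)); auto;
      try (apply HY; lra); try lra.
    - apply Hh; lra.
    - apply discount_eq_theta0; [lra|exact (proj1 Hr)]. }
  assert (HW : forall t, r <= t <= 1 -> 0 < inverse_value pi phi (Y t)).
  { intros t Ht; destruct (HY t ltac:(lra)) as [Hp Hd].
    apply inverse_value_pos; auto; split; [assumption|].
    apply (discount_lt_1 pi phi (adverse_weight pi t)); auto; apply Hh; lra. }
  (* Here every discount lies at or beyond the vertex of W, where W decreases. *)
  assert (Hinc : ys <= r -> increasing_on r 1 V).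
  { intros Hys t u H1 H2 H3; rewrite !HV by lra.
    apply Rmult_lt_compat_l; [assumption|].
    pose proof (HW t ltac:(lra)); pose proof (HW u ltac:(lra)).
    apply Rinv_lt_contravar; [apply Rmult_lt_0_compat; assumption|].
    pose proof (HYlt t u ltac:(lra) H2 H3) as Hlt.
    assert (r <= Y t).
    { rewrite <- HYr; destruct H1 as [H1|<-]; [left; apply HYlt; lra|lra]. }
    pose proof (inverse_value_diff pi phi (Y t) (Y u) Hpi) as Hd; fold ys in Hd.
    assert (0 < (2 - pi) * (Y u - Y t) * (Y t + Y u - 2 * ys))
      by (repeat apply Rmult_lt_0_compat; lra).
    lra. }
  assert (Hdec : Y 1 <= ys -> decreasing_on r 1 V).
  { intros Hys t u H1 H2 H3; rewrite !HV by lra.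
    apply Rmult_lt_compat_l; [assumption|].
    pose proof (HW t ltac:(lra)); pose proof (HW u ltac:(lra)).
    apply Rinv_lt_contravar; [apply Rmult_lt_0_compat; assumption|].
    pose proof (HYlt t u ltac:(lra) H2 H3) as Hlt.
    assert (Y u <= Y 1).
    { destruct H3 as [H3| ->]; [left; apply HYlt; lra|lra]. }
    pose proof (inverse_value_diff pi phi (Y t) (Y u) Hpi) as Hd; fold ys in Hd.
    assert (0 < (2 - pi) * (Y u - Y t) * (2 * ys - (Y t + Y u)))
      by (repeat apply Rmult_lt_0_compat; lra).
    lra. }
  split; [|split].
  - intros phi0 H0 Hlt.
    assert (Hys : ys <= r) by (left; apply (Hcross phi phi0); assumption).
    specialize (Hinc Hys); split; [|assumption].
    intros t u H1 H2 H3; rewrite !HQ by lra; apply Hinc; assumption.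
  - intros phi0 H0 Hbet.
    assert (Hys : r <= ys).
    { destruct (Rle_lt_or_eq_dec phi0 phi (proj1 Hbet)) as [Hlt|Heq0].
      - left; apply (Hcross phi phi0); assumption.
      - right; subst phi0; apply (Hcrit phi H0). }
    pose proof (proj2 (gstar_pos_iff pi phi Hpi Hphi) (proj2 Hbet)) as Hg.
    set (g := gstar pi phi) in *.
    (* The solution of (1 - theta) / theta = g*; positivity of [g] puts it strictly below 1. *)
    set (ts := / (1 + g)).
    assert (Hts : 0 < ts) by (apply Rinv_0_lt_compat; lra).
    assert (Hts1 : ts < 1)
      by (rewrite <- Rinv_1; apply Rinv_lt_contravar; lra).
    assert (HYts : Y ts = ys).
    { destruct (HY ts ltac:(lra)) as [Hp Hd].
      apply (discount_eq_unique pi phi (adverse_weight pi ts)); auto.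
      - apply Hh; lra.
      - apply critical_discount_pos; assumption.
      - replace (adverse_weight pi ts) with ((1 - pi) * g).
        + apply discount_eq_gstar; assumption.
        + unfold adverse_weight, ts; field; lra. }
    assert (Hsign : forall t, 0 < t <= 1 ->
      (Y t < ys <-> t < ts) /\ (ys < Y t <-> ts < t)).
    { intros t Ht; rewrite <- HYts.
      destruct (Rtotal_order t ts) as [Hlt|[->|Hgt]].
      - pose proof (HYlt t ts ltac:(lra) Hlt ltac:(lra)); lra.
      - lra.
      - pose proof (HYlt ts t ltac:(lra) Hgt ltac:(lra)); lra. }
    set (F := fun t => k / inverse_value pi phi (Y t)).
    assert (HF : forall t, r <= t <= 1 ->
      exists c, 0 < c /\ is_derive F t (c * (Y t - ys)))
      by (intros t Ht; apply value_derive; auto; lra).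
    assert (HF' : forall t, r <= t <= 1 -> is_derive F t (Derive F t)).
    { intros t Ht; destruct (HF t Ht) as (c & _ & Hc).
      apply Derive_correct; eexists; exact Hc. }
    exists ts, (Derive F); split; [|split; [|split]].
    + split; [|assumption].
      destruct (Rle_or_lt r ts) as [|Hlt]; [assumption|].
      apply Hsign in Hlt; lra.
    + apply derivative_on_ext with F; [|assumption].
      intros t Ht; rewrite HQ, HV by assumption; reflexivity.
    + apply derivative_on_ext with F; assumption.
    + intros t Ht; destruct (HF t Ht) as (c & Hc & Hd).
      rewrite (is_derive_unique _ _ _ Hd).
      destruct (Hsign t ltac:(lra)) as [<- <-].
      split; split; intros; nra.
  - intros [Hge _].
    (* At theta = 1 the weight h vanishes and [discount_eq] is linear. For [ys] the weight is
       nonpositive, so the same linear expression is at least as large. *)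
    assert (Hys : Y 1 <= ys).
    { assert (Hg : gstar pi phi <= 0).
      { apply Rnot_lt_le; intros Hg.
        apply gstar_pos_iff in Hg; auto; lra. }
      destruct (HY 1 ltac:(lra)) as [Hp Hd].
      pose proof (discount_eq_gstar pi phi Hpi Hphi) as Hs; fold ys in Hs.
      pose proof (critical_discount_pos pi phi Hpi Hphi) as Hysp; fold ys in Hysp.
      unfold discount_eq, adverse_weight in Hd, Hs.
      set (a := pi * (1 - phi)) in *.
      assert (Ha : 0 < a) by (apply Rmult_lt_0_compat; lra).
      assert (0 < ys * (ys + a)) by (apply Rmult_lt_0_compat; lra).
      assert (0 <= (1 - pi) * - gstar pi phi * (ys * (ys + a)))
        by (apply Rmult_le_pos; [apply Rmult_le_pos|]; lra).
      assert (0 < pi * phi + (2 - pi) * a) by nra.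
      apply Rmult_le_reg_l with (pi * phi + (2 - pi) * a); [assumption|].
      replace ((1 - 1) / 1) with 0 in Hd by field.
      lra. }
    specialize (Hdec Hys); split; [|assumption].
    intros t u H1 H2 H3; rewrite !HQ by lra; apply Hdec; assumption.
Qed.
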